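(* Let $X$ be a real-valued random variable, $\mathsf J_X$ its integrated distribution function and $\mathsf K_X$ its integrated quantile function. Then: (i) $\mathsf K_X$ is convex and lower semicontinuous; it takes finite values on $(0,1)$ and equals $+\infty$ outside $[0,1]$. (ii) The Fenchel transform of $\mathsf K_X$ is $\mathsf J_X$, i.e. $\mathsf J_X(x)=\sup_{u\in\mathbb R}\{xu-\mathsf K_X(u)\}$ for any $x\in\mathbb R$. (iii) $\min_{u\in\mathbb R}\mathsf K_X(u)=0$ and $\{u\in\mathbb R:\mathsf K_X(u)=0\}=[F_X(0-0),F_X(0)]$. (iv) For every $u\in[0,1]$, $\mathsf K_X(u)=\int_{u_0}^u q_X(s)\,ds$, where $u_0$ is any zero of $\mathsf K_X$ and $q_X$ is any quantile function of $X$. (v) $\mathsf K_X(0)=\mathsf E[X^-]$ and $\mathsf K_X(1)=\mathsf E[X^+]$. (vi) The subdifferential of $\mathsf K_X$ satisfies $\partial\mathsf K_X(u)=[q_X^L(u),q_X^R(u)]$ for $u\in(0,1)$; in particular $(\mathsf K_X)'_-(u)=q_X^L(u)$ and $(\mathsf K_X)'_+(u)=q_X^R(u)$. (vii) $\mathsf K_{-X}(u)=\mathsf K_X(1-u)$ for all $u\in[0,1]$.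
   Context: $F_X(x)=\mathsf P(X\le x)$; $F_X(x-0)$ is the left limit at $x$ (so $F_X(0-0)=\mathsf P(X<0)$). The integrated distribution function of $X$ is $\mathsf J_X(x)=\int_0^xF_X(t)\,dt$, $x\in\mathbb R$ (with $\int_a^b:=-\int_b^a$ if $b<a$). The integrated quantile function of $X$ is $\mathsf K_X(u)=\sup_{x\in\mathbb R}\{xu-\mathsf J_X(x)\}\in\mathbb R\cup\{+\infty\}$, $u\in\mathbb R$. A quantile function of $X$ is any $q_X:(0,1)\to\mathbb R$ with $F_X(q_X(u)-0)\le u\le F_X(q_X(u))$ for all $u\in(0,1)$. $q_X^L(u)=\inf\{x:F_X(x)\ge u\}$ and $q_X^R(u)=\inf\{x:F_X(x)>u\}$. $y^+=\max(y,0)$, $y^-=\max(-y,0)$. No integrability of $X$ is assumed; values $+\infty$ are allowed in (iv), (v), (vii). The subdifferential of a convex $f:\mathbb R\to\mathbb R\cup\{+\infty\}$ at $x$ is $\partial f(x)=\{u\in\mathbb R: f(y)\ge f(x)+u(y-x)\ \forall y\in\mathbb R\}$; $f'_\pm$ are one-sided derivatives. *)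

(* Defs.v *)
From mathcomp Require Import all_boot all_order all_algebra.
From mathcomp Require Import all_classical all_reals all_analysis.
From mathcomp Require Import measurable_realfun.
Import Order.TTheory GRing.Theory Num.Theory.
Import numFieldNormedType.Exports.

Set Implicit Arguments.
Unset Strict Implicit.
Unset Printing Implicit Defensive.

Local Open Scope classical_set_scope.
Local Open Scope ring_scope.
Local Open Scope ereal_scope.

(* The integral is taken over the open interval, so that the values of f at the
   endpoints (where a quantile function need not be defined) are irrelevant. *)
Definition oriented_integral (R : realType) (f : R -> \bar R) (a b : R)
    : \bar R :=
  if (a <= b)%R then \int[lebesgue_measure]_(t in `]a, b[) f t
  else - \int[lebesgue_measure]_(t in `]b, a[) f t.

Definition fenchel (R : realType) (f : R -> \bar R) (u : R) : \bar R :=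
  ereal_sup (range (fun x : R => (x * u)%:E - f x)).

(* Meant for functions that do not take the value -oo. *)
Definition convex_ereal (R : realType) (f : R -> \bar R) : Prop :=
  forall x y t : R, (0 < t < 1)%R ->
    f (t * x + (1 - t) * y)%R <= t%:E * f x + (1 - t)%:E * f y.

Definition subdifferential (R : realType) (f : R -> \bar R) (x : R) : set R :=
  [set v : R | forall y : R, f x + (v * (y - x))%:E <= f y].

(* Meant for points x at which f is finite. *)
Definition is_left_derivative (R : realType) (f : R -> \bar R) (x l : R)
    : Prop :=
  (f (x + h)%R - f x) * (h^-1)%:E @[h --> (0 : R)^'-] --> l%:E.

Definition is_right_derivative (R : realType) (f : R -> \bar R) (x l : R)
    : Prop :=
  (f (x + h)%R - f x) * (h^-1)%:E @[h --> (0 : R)^'+] --> l%:E.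

Definition cdf_left (d : measure_display) (T : measurableType d) (R : realType)
    (P : probability T R) (X : {RV P >-> R}) (x : R) : \bar R :=
  lim (cdf X t @[t --> x^'-]).

Definition integrated_cdf (d : measure_display) (T : measurableType d)
    (R : realType) (P : probability T R) (X : {RV P >-> R}) (x : R) : \bar R :=
  oriented_integral (cdf X) 0 x.

Definition integrated_quantile (d : measure_display) (T : measurableType d)
    (R : realType) (P : probability T R) (X : {RV P >-> R}) (u : R) : \bar R :=
  fenchel (integrated_cdf X) u.

(* A quantile function is defined on ]0, 1[ only; q is an arbitrary total
   extension of it. *)
Definition is_quantile (d : measure_display) (T : measurableType d)
    (R : realType) (P : probability T R) (X : {RV P >-> R}) (q : R -> R)
    : Prop :=
  forall u : R, (0 < u < 1)%R ->
    cdf_left X (q u) <= u%:E /\ u%:E <= cdf X (q u).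

(* For u in ]0, 1[ the two sets below are nonempty and bounded below, so that
   their infima are the genuine ones. *)
Definition quantileL (d : measure_display) (T : measurableType d)
    (R : realType) (P : probability T R) (X : {RV P >-> R}) (u : R) : R :=
  inf [set x : R | u%:E <= cdf X x].

Definition quantileR (d : measure_display) (T : measurableType d)
    (R : realType) (P : probability T R) (X : {RV P >-> R}) (u : R) : R :=
  inf [set x : R | u%:E < cdf X x].

(* Main.v *)
(** A number [p] is a subgradient of [J_X] at [x] iff [F_X(x-0) <= p <= F_X(x)],
    and by the equality case of the Fenchel-Young inequality this holds iff
    [K_X(p) = x p - J_X(x)].  Since [F_X(x)] is such a [p], [J_X] is its own
    biconjugate; since every [u] in ]0, 1[ is a subgradient at the points of
    [[q_X^L(u), q_X^R(u)]], these points are exactly the subgradients of [K_X]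
    at [u].  A function is determined up to a constant by a selection of its
    subgradients, which is moreover its derivative in the integral sense: on
    [[a, b]] inside ]0, 1[ this gives [K_X(b) - K_X(a)] as the integral of any
    quantile function, and convexity together with lower semicontinuity carry
    the formula to the endpoints 0 and 1.  The same uniqueness gives
    [J_{-X}(x) = x + J_X(-x)], hence [K_{-X}(u) = K_X(1 - u)], and
    [K_X(1) = E X^+] is the tail formula for the expectation. *)
Require Import Defs.
From mathcomp Require Import all_boot all_order all_algebra.
From mathcomp Require Import all_classical all_reals all_analysis.
From mathcomp Require Import measurable_realfun.
From mathcomp Require Import ring lra.
Import Order.TTheory GRing.Theory Num.Theory.
Import numFieldNormedType.Exports.

Set Implicit Arguments.
Unset Strict Implicit.
Unset Printing Implicit Defensive.

Local Open Scope classical_set_scope.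
Local Open Scope ring_scope.
Local Open Scope ereal_scope.

(** * Real functions with a prescribed selection of subgradients *)

Section RealSubgradient.
Local Open Scope ring_scope.
Context {R : realType}.
Implicit Types (g G H : R -> R) (a b : R).

(** The subgradient inequalities at [x] and at [y] bound [G y - G x] below by [g x * (y - x)] and
    above by [g y * (y - x)]. *)
Lemma subgradient_nondecreasing g G (i : interval R) :
  {in i &, forall x y, g x * (y - x) <= G y - G x} ->
  {in i &, nondecreasing_fun g}.
Proof.
move=> gG x y xi yi; rewrite le_eqVlt => /predU1P[->//|xy].
have := gG _ _ xi yi; have := gG _ _ yi xi => gy gx.
have : (g x * (y - x) <= g y * (y - x))%R by lra.
by rewrite ler_pM2r// subr_gt0.
Qed.

(* For x <= y, G and H both grow by an amount in [g x (y - x), g y (y - x)];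
   over a uniform subdivision of [a, b] into N pieces these discrepancies add up
   to at most (g b - g a) (b - a) / N. *)
Lemma subgradient_unique g G H a b : (a <= b) ->
  {in `[a, b] &, forall x y, g x * (y - x) <= G y - G x} ->
  {in `[a, b] &, forall x y, g x * (y - x) <= H y - H x} ->
  (G b - G a = H b - H a).
Proof.
move=> ab gG gH; apply/eqP; rewrite -subr_eq0 -normr_eq0 eq_le normr_ge0 andbT.
rewrite leNgt; apply/negP; set e := `|_| => e_gt0.
(* Chosen so that [N.+1] exceeds [(g b - g a) * (b - a) / e]: the accumulated discrepancy
   [(g b - g a) * d] is then below [e], a contradiction. *)
pose N := Num.truncn ((g b - g a) * (b - a) / e).
pose d := (b - a) / N.+1%:R.
have d_ge0 : 0 <= d by rewrite divr_ge0// subr_ge0.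
pose x k := a + k%:R * d.
have x_in k : (k <= N.+1)%N -> x k \in `[a, b].
  move=> kN; rewrite in_itv/=; apply/andP; split.
    by rewrite lerDl mulr_ge0.
  rewrite -lerBrDl /d mulrCA ler_piMr ?subr_ge0//.
  by rewrite ler_pdivrMr// mul1r ler_nat.
have step k : (k <= N.+1)%N ->
    `|(G (x k) - G a) - (H (x k) - H a)| <= (g (x k) - g a) * d.
  elim: k => [_|k IH kN].
    by rewrite /x mul0r addr0 !subrr normr0 mul0r.
  have {}IH := IH (ltnW kN).
  have xk := x_in k (ltnW kN); have xk1 := x_in k.+1 kN.
  have dE : x k.+1 - x k = d by rewrite /x -natr1; ring.
  have G1 := gG _ _ xk xk1; have G2 := gG _ _ xk1 xk.
  have H1 := gH _ _ xk xk1; have H2 := gH _ _ xk1 xk.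
  rewrite -opprB dE in G2; rewrite -opprB dE in H2.
  rewrite dE in G1; rewrite dE in H1.
  move: IH; rewrite !ler_norml => /andP[I1 I2]; apply/andP; split; lra.
have xN : x N.+1 = b.
  by rewrite /x /d mulrCA divff ?pnatr_eq0// mulr1 addrC subrK.
have := step _ (leqnn _); rewrite xN -/e /d mulrA ler_pdivlMr// leNgt.
by rewrite [(e * _)]mulrC -ltr_pdivrMr// truncnS_gt.
Qed.

End RealSubgradient.

(** * Integrals of monotone functions over bounded intervals *)

Section IntervalIntegral.
Context {R : realType}.
Implicit Types (f g G H : R -> R) (a b c : R).

Local Notation mu := (@lebesgue_measure R).

(** The points of [i] where [f] is at least [r] form an interval, and the rays [[r, +oo[] generate
    the Borel sets. *)
Lemma nondecreasing_in_measurable (i : interval R) f :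
  {in i &, nondecreasing_fun f} -> measurable_fun [set` i] f.
Proof.
move=> ndf mi; apply: (measurability (@RGenCInfty.G R)) => //.
  exact: RGenCInfty.measurableE.
move=> /= _ [_] [r] -> <-.
apply: is_interval_measurable => s t [/= si fs] [/= ti _] u /andP[su ut].
have ui : u \in i by apply: (interval_is_interval si ti); rewrite su ut.
split => //=; move: fs; rewrite !in_itv/= !andbT => /le_trans; apply.
exact: ndf.
Qed.

Lemma integral_itvoo_bounds f a b m M : (a <= b)%R ->
  measurable_fun `]a, b[ f ->
  (forall x, x \in `]a, b[ -> m <= f x <= M)%R ->
  (m * (b - a))%:E <= \int[mu]_(x in `]a, b[) (f x)%:E <= (M * (b - a))%:E.
Proof.
move=> ab mf fmM.
have muab : mu `]a, b[ = (b - a)%:E.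
  rewrite lebesgue_measure_itv/= lte_fin; case: ltP => //.
  by move=> ba; rewrite (_ : b = a) ?subrr//; apply/eqP; rewrite eq_le ba.
have cst_int (k : R) : mu.-integrable `]a, b[ (EFin \o cst k).
  apply: measurable_bounded_integrable => //; first by rewrite /= muab ltry.
  exact: bounded_cst.
have f_int : mu.-integrable `]a, b[ (EFin \o f).
  apply: measurable_bounded_integrable => //; first by rewrite /= muab ltry.
  exists (`|m| + `|M|)%R; split; first exact: num_real.
  move=> N mMN x xab; apply: (le_trans _ (ltW mMN)).
  have /andP[mf0 fM] := fmM x xab.
  rewrite ler_norml; apply/andP.
  have := ler_norm M; have := ler_norm (- m); rewrite normrN.
  have := normr_ge0 m; have := normr_ge0 M; split; lra.
have cstE (k : R) : (k * (b - a))%:E = \int[mu]_(x in `]a, b[) (cst k x)%:E.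
  by rewrite (integral_cst mu _ k%:E)//= muab.
rewrite !cstE; apply/andP; split; apply: le_integral => //;
  try exact: cst_int; try exact: f_int; move=> x /[!inE] xab;
  by rewrite lee_fin /=; case/andP: (fmM x xab).
Qed.

(** The point [c] is Lebesgue-null: it is put into the right-hand piece to form a disjoint union and
    then dropped. If [c] is an endpoint, one piece is empty. *)
Lemma integral_itvoo_split f a c b : (a <= c <= b)%R ->
  measurable_fun `]a, b[ f ->
  \int[mu]_(x in `]a, b[) (f x)%:E =
  \int[mu]_(x in `]a, c[) (f x)%:E + \int[mu]_(x in `]c, b[) (f x)%:E.
Proof.
move=> /andP[]; rewrite le_eqVlt => /predU1P[<- _ _|ac].
  rewrite [X in _ = X + _](_ : _ = 0) ?add0e//.
  by rewrite set_itv_ge ?integral_set0 ?bnd_simp ?ltxx.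
rewrite le_eqVlt => /predU1P[<- _|cb mf].
  rewrite [X in _ = _ + X](_ : _ = 0) ?adde0//.
  by rewrite set_itv_ge ?integral_set0 ?bnd_simp ?ltxx.
have mfE (i : interval R) : [set` i] `<=` `]a, b[ ->
    measurable_fun [set` i] (fun x => (f x)%:E).
  by move=> ?; apply/measurable_EFinP; exact: measurable_funS mf.
have abE : `]a, b[%classic = `]a, c[ `|` `[c, b[ :> set R.
  by rewrite -itv_bndbnd_setU ?bnd_simp// ltW.
rewrite {1}abE integral_setU//=.
- congr (_ + _); rewrite -integral_itv_obnd_cbnd//.
  by apply: mfE; apply: subset_itvr; rewrite bnd_simp ltW.
- by rewrite -abE; exact: mfE.
- rewrite disj_set2E; apply/eqP/seteqP; split => // x [] /=.
  by rewrite !in_itv/= => /andP[_ xc] /andP[+ _]; rewrite leNgt xc.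
Qed.

(** Since [g] is nondecreasing, its indefinite integral [H] also has [g] as a selection of
    subgradients, so [H] and [G] have the same increment by [subgradient_unique]. *)
Lemma integral_subgradient g G a b : (a <= b)%R ->
  {in `[a, b] &, forall x y, g x * (y - x) <= G y - G x}%R ->
  \int[mu]_(x in `]a, b[) (g x)%:E = (G b - G a)%:E.
Proof.
move=> ab gG.
have ndg := subgradient_nondecreasing gG.
have mg : measurable_fun `]a, b[ g.
  apply: nondecreasing_in_measurable => x y xab yab.
  by apply: ndg; exact: subset_itv_oo_cc.
pose I x y := \int[mu]_(t in `]x, y[) (g t)%:E.
have gI x y : x \in `[a, b] -> y \in `[a, b] -> (x <= y)%R ->
    (g x * (y - x))%:E <= I x y <= (g y * (y - x))%:E.
  move=> xab yab xy; apply: integral_itvoo_bounds => //.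
    apply: measurable_funS mg => //; apply: subset_itv; rewrite bnd_simp.
      by case/andP: xab.
    by case/andP: yab.
  move=> t txy; have tab : t \in `[a, b].
    move: xab yab txy; rewrite !in_itv/=; lra.
  by rewrite !ndg//; move: txy; rewrite in_itv/=; lra.
have Ifin x y : x \in `[a, b] -> y \in `[a, b] -> (x <= y)%R ->
    I x y \is a fin_num.
  move=> xab yab xy; have /andP[l u] := gI _ _ xab yab xy.
  rewrite fin_numE -ltNye -ltey.
  by rewrite (lt_le_trans _ l) ?ltNyr// (le_lt_trans u) ?ltry.
have aab : a \in `[a, b] by rewrite in_itv/= lexx.
have bab : b \in `[a, b] by rewrite in_itv/= lexx ab.
pose H x := fine (I a x).
have HB x y : x \in `[a, b] -> y \in `[a, b] -> (x <= y)%R ->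
    (H y - H x)%:E = I x y.
  move=> xab yab xy.
  have ax : (a <= x)%R by case/andP: xab.
  have ay : (a <= y)%R by case/andP: yab.
  rewrite /H EFinB !fineK ?Ifin//.
  rewrite {1}/I (@integral_itvoo_split _ _ x) ?ax//.
    by rewrite [X in X - _]addeC addeK ?Ifin.
  apply: measurable_funS mg => //; apply: subset_itvl; rewrite bnd_simp.
  by case/andP: yab.
have gH : {in `[a, b] &, forall x y, g x * (y - x) <= H y - H x}%R.
  move=> x y xab yab; have [xy|/ltW yx] := leP x y.
    by have /andP[+ _] := gI _ _ xab yab xy; rewrite -HB// lee_fin.
  have /andP[_ +] := gI _ _ yab xab yx; rewrite -HB// lee_fin; lra.
rewrite (subgradient_unique ab gG gH) HB//.
Qed.

End IntervalIntegral.

(** * Fenchel transforms of finite functions *)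

Section Fenchel.
Context {R : realType}.
Implicit Types (j : R -> R) (x y u v : R).

(** The Fenchel-Young inequality. *)
Lemma fenchel_ge j x u : (x * u - j x)%:E <= fenchel (EFin \o j) u.
Proof. by apply: ereal_sup_ubound; exists x. Qed.

(** A supremum of functions affine in [u] is convex; for the same reason it is lower semicontinuous,
    which is the next lemma. *)
Lemma fenchel_convex j : convex_ereal (fenchel (EFin \o j)).
Proof.
move=> u v t /andP[t0 t1]; apply: ge_ereal_sup => _ [x _ <-] /=.
have -> : (x * (t * u + (1 - t) * v))%:E - (j x)%:E =
    t%:E * (x * u - j x)%:E + (1 - t)%:E * (x * v - j x)%:E.
  by rewrite -EFinB -!EFinM -EFinD; congr EFin; ring.
by apply: leeD; apply: lee_wpmul2l; try exact: fenchel_ge;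
  rewrite lee_fin ?subr_ge0 ltW.
Qed.

Lemma fenchel_lower_semicontinuous j :
  lower_semicontinuous (fenchel (EFin \o j)).
Proof.
move=> u a /ereal_sup_gt[_ [x _ <-]] /=; rewrite -EFinB lte_fin => axu.
exists [set v | (a < x * v - j x)%R].
  have : (x * v - j x)%R @[v --> u] --> (x * u - j x)%R.
    by apply: cvgB; [apply: cvgMr; exact: cvg_id|exact: cvg_cst].
  by move/cvgr_gt; exact.
by move=> v /= av; apply: lt_le_trans (fenchel_ge j x v); rewrite lte_fin.
Qed.

(** Equality case of Fenchel-Young: both sides say that the supremum over [y] of [y * u - j y] is
    attained at [x]. *)
Lemma fenchel_eqP j x u :
  fenchel (EFin \o j) u = (x * u - j x)%:E <->
  (forall y, j x + u * (y - x) <= j y)%R.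
Proof.
split=> [E y|xu].
  by have := fenchel_ge j y u; rewrite E lee_fin; lra.
apply/eqP; rewrite eq_le fenchel_ge andbT.
apply: ge_ereal_sup => _ [y _ <-] /=.
by have := xu y; rewrite -EFinB lee_fin; lra.
Qed.

(** The term of index [u] of the second transform equals [j x] by the equality case, and no term
    exceeds [j x] by Fenchel-Young. *)
Lemma fenchel_biconjugate j x u :
  (forall y, j x + u * (y - x) <= j y)%R ->
  (j x)%:E = fenchel (fenchel (EFin \o j)) x.
Proof.
move=> /fenchel_eqP E; apply/eqP; rewrite eq_le; apply/andP; split.
  apply: le_ereal_sup_tmp; exists ((u * x)%:E - fenchel (EFin \o j) u).
    by exists u.
  by rewrite E -EFinB lee_fin; lra.
apply: ge_ereal_sup => _ [v _ <-] /=.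
(* If the transform is [+oo] at [v], the term is [-oo]; the value [-oo] is excluded by
   Fenchel-Young. *)
have := fenchel_ge j x v; case: (fenchel _ v) => [k| |].
- by rewrite -EFinB !lee_fin; lra.
- by rewrite leNye.
- by rewrite leeNy_eq.
Qed.

(** Write K for the transform and let [x] be a subgradient of K at [u]. Testing it at a subgradient
    [p] of [j] at [x], where K(p) = x p - j(x), gives K(u) <= x u - j(x), the equality case of
    Fenchel-Young. *)
Lemma subdifferential_fenchel j u :
  (forall x, exists p, forall y, j x + p * (y - x) <= j y)%R ->
  fenchel (EFin \o j) u \is a fin_num ->
  subdifferential (fenchel (EFin \o j)) u =
  [set x | forall y, j x + u * (y - x) <= j y]%R.
Proof.
move=> subj Kfin; apply/seteqP; split => [x Kx|x /= /fenchel_eqP E v].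
  apply/fenchel_eqP; have [p /fenchel_eqP pE] := subj x.
  apply/eqP; rewrite eq_le fenchel_ge andbT.
  have := Kx p; rewrite -(fineK Kfin) pE -!EFinD !lee_fin; lra.
by rewrite E -EFinD; apply: le_trans (fenchel_ge j x v); rewrite lee_fin; lra.
Qed.

End Fenchel.

(** * Distribution functions: right continuity, limits, left limits *)

Section CdfBasics.
Context d (T : measurableType d) (R : realType) (P : probability T R).
Implicit Types (X : {RV P >-> R}) (x u p : R).

Lemma cdf_fineE X : cdf X = EFin \o (fine \o cdf X).
Proof. by apply/funext => x /=; rewrite fineK// fin_num_measure. Qed.

Lemma fine_cdf_nondecreasing X : nondecreasing_fun (fine \o cdf X).
Proof.
by move=> x y xy /=; rewrite fine_le ?fin_num_measure// cdf_nondecreasing.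
Qed.

Lemma fine_cdf_ge0 X x : (0 <= fine (cdf X x))%R.
Proof. exact: fine_ge0. Qed.

Lemma fine_cdf_le1 X x : (fine (cdf X x) <= 1)%R.
Proof. by rewrite -lee_fin fineK ?fin_num_measure// cdf_le1. Qed.

Lemma le_cdf_right X x p :
  (forall y, x < y -> p <= fine (cdf X y))%R -> (p <= fine (cdf X x))%R.
Proof.
move=> py; rewrite -lee_fin fineK ?fin_num_measure//.
apply: cvge_ge (@cdf_right_continuous _ _ _ _ X x).
near=> y; rewrite -[leRHS]fineK ?fin_num_measure// lee_fin; apply: py.
by near: y; exact: nbhs_right_gt.
Unshelve. all: by end_near. Qed.

(** Comes from the limit 1 at [+oo]. Together with [cdf_lt_ex] it makes the sets defining the two
    quantiles nonempty and bounded below. *)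
Lemma cdf_gt_ex X p : (p < 1)%R -> exists x, (p < fine (cdf X x))%R.
Proof.
move=> p1; apply: contrapT => /forallNP Fp.
have : 1 <= p%:E.
  apply: cvge_le (@cvg_cdfy1 _ _ _ _ X); apply: nearW => x.
  rewrite -[leLHS]fineK ?fin_num_measure// lee_fin leNgt; exact/negP/Fp.
by rewrite lee_fin leNgt p1.
Qed.

Lemma cdf_lt_ex X p : (0 < p)%R -> exists x, (fine (cdf X x) < p)%R.
Proof.
move=> p0; apply: contrapT => /forallNP Fp.
have : p%:E <= 0.
  apply: cvge_ge (@cvg_cdfNy0 _ _ _ _ X); apply: nearW => x.
  rewrite -[leRHS]fineK ?fin_num_measure// lee_fin leNgt; exact/negP/Fp.
by rewrite lee_fin leNgt p0.
Qed.

(** [cdf_left] is a [lim], which carries information only once convergence is known. Monotonicity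
    and the bound 1 provide it, and the left limit is then the supremum of the values on the
    left. *)
Lemma cdf_left_leP X x u :
  cdf_left X x <= u%:E <-> (forall t, t < x -> fine (cdf X t) <= u)%R.
Proof.
have cvgF : cvg ((fine \o cdf X) t @[t --> x^'-]).
  apply: nondecreasing_at_left_is_cvgr.
    by apply: nearW => y s t _ _; exact: fine_cdf_nondecreasing.
  by apply: nearW => y; exists 1%R => _ [t _ <-]; exact: fine_cdf_le1.
have -> : cdf_left X x = (lim ((fine \o cdf X) t @[t --> x^'-]))%:E.
  apply: cvg_lim => //; apply/fine_cvgP; split => //.
  by apply: nearW => t; exact: fin_num_measure.
rewrite lee_fin; split => [Fu t tx|Fu].
  apply: le_trans Fu; apply: limr_ge => //; near=> s.
  apply: fine_cdf_nondecreasing.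
  by near: s; exact: nbhs_left_ge.
apply: limr_le => //; near=> s; apply: Fu.
by near: s; exact: nbhs_left_lt.
Unshelve. all: by end_near. Qed.

End CdfBasics.

(** * The integrated distribution function and its subgradients *)

Section IntegratedCdf.
Context d (T : measurableType d) (R : realType) (P : probability T R).
Context (X : {RV P >-> R}).
Implicit Types (x y u p : R).

Local Notation F := (fine \o cdf X).
Local Notation J := (integrated_cdf X).
Local Notation j := (fine \o integrated_cdf X).
Local Notation mu := (@lebesgue_measure R).

Let mF (i : interval R) : measurable_fun [set` i] F.
Proof.
by apply: nondecreasing_in_measurable => x y _ _; exact: fine_cdf_nondecreasing.
Qed.

Let I x y := \int[mu]_(t in `]x, y[) (F t)%:E.

Let I_fin x y : (x <= y)%R -> I x y \is a fin_num.
Proof.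
move=> xy; have /andP[l u] : (0 * (y - x))%:E <= I x y <= (1 * (y - x))%:E.
  apply: integral_itvoo_bounds => // t _.
  by rewrite fine_cdf_ge0 fine_cdf_le1.
rewrite fin_numE -ltNye -ltey.
by rewrite (lt_le_trans _ l) ?ltNyr// (le_lt_trans u) ?ltry.
Qed.

Let JE x : J x = if (0 <= x)%R then I 0 x else - I x 0.
Proof. by rewrite /integrated_cdf cdf_fineE. Qed.

Lemma integrated_cdf_fin_num x : J x \is a fin_num.
Proof.
by rewrite JE; case: (leP 0%R x) => [|/ltW] x0; rewrite ?fin_numN; exact: I_fin.
Qed.

Lemma integrated_cdfE : J = EFin \o j.
Proof. by apply/funext => x /=; rewrite fineK// integrated_cdf_fin_num. Qed.

Lemma integrated_cdf0 : j 0%R = 0%R.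
Proof. by rewrite /= JE lexx /I set_itv_ge ?integral_set0// bnd_simp ltxx. Qed.

(** Additivity in the possible sign patterns of [x] and [y]. It removes the orientation: afterwards
    [j] is handled through its increments and its value at 0. *)
Lemma integral_cdf x y : (x <= y)%R ->
  \int[mu]_(t in `]x, y[) (F t)%:E = (j y - j x)%:E.
Proof.
move=> xy; have split_I a c b : (a <= c <= b)%R -> I a b = I a c + I c b.
  by move=> acb; exact: integral_itvoo_split.
rewrite EFinB /comp !fineK ?integrated_cdf_fin_num// !JE -/(I x y).
have [x0|x0] := leP 0%R x; have [y0|y0] := leP 0%R y.
- by rewrite (@split_I 0%R x y) ?x0// [X in X - _]addeC addeK ?I_fin.
- by have := lt_le_trans y0 (le_trans x0 xy); rewrite ltxx.
- by rewrite oppeK (@split_I x 0%R y) ?y0 ?(ltW x0)// addeC.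
- rewrite oppeK (@split_I x y 0%R) ?xy ?(ltW y0)//.
  by rewrite [RHS]addeC addeK// I_fin// ltW.
Qed.

(** The first condition is F(x-0) <= p written without a limit. Increments of [j] lie between values
    of [F] times the length of the interval; dividing by the length gives the direct implication,
    with right continuity to reach [F x] itself. *)
Lemma integrated_cdf_subgradientP x p :
  (forall y, j x + p * (y - x) <= j y)%R <->
  (forall t, t < x -> F t <= p)%R /\ (p <= F x)%R.
Proof.
(* Each use below keeps one of the two bounds and fills in the other, with 0 or 1 for [F] where
   nothing sharper is wanted. *)
have bnd m M a b : (a <= b)%R -> (forall t, a < t < b -> m <= F t <= M)%R ->
    (m * (b - a) <= j b - j a <= M * (b - a))%R.
  move=> ab mFM.
  have /(_ _ _ mFM) := integral_itvoo_bounds ab (@mF `]a, b[).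
  by rewrite integral_cdf// !lee_fin.
split => [px|[pl pr] y].
  split.
    move=> t tx; rewrite -(@ler_pM2r _ (x - t)) ?subr_gt0//.
    have /andP[+ _] : (F t * (x - t) <= j x - j t <= 1 * (x - t))%R.
      apply: bnd => [|s /andP[ts _]]; first exact: ltW.
      by rewrite fine_cdf_le1 fine_cdf_nondecreasing// ltW.
    have := px t; rewrite /=; lra.
  apply: le_cdf_right => y xy.
  rewrite -(@ler_pM2r _ (y - x)) ?subr_gt0//.
  have /andP[_ +] : (0 * (y - x) <= j y - j x <= F y * (y - x))%R.
    apply: bnd => [|s /andP[_ sy]]; first exact: ltW.
    by rewrite fine_cdf_ge0 fine_cdf_nondecreasing// ltW.
  have := px y; rewrite /=; lra.
have [xy|/ltW yx] := leP x y.
  have /andP[+ _] : (p * (y - x) <= j y - j x <= 1 * (y - x))%R.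
    apply: bnd => // s /andP[xs _]; rewrite fine_cdf_le1 andbT.
    by apply: le_trans pr _; apply: fine_cdf_nondecreasing; exact: ltW.
  by rewrite lerBrDl.
have /andP[_ +] : (0 * (x - y) <= j x - j y <= p * (x - y))%R.
  by apply: bnd => // s /andP[_ sx]; rewrite fine_cdf_ge0 pl.
rewrite /=; lra.
Qed.

Lemma integrated_cdf_subgradient x y : (j x + F x * (y - x) <= j y)%R.
Proof.
move: y; apply/integrated_cdf_subgradientP; split => [t /ltW|//].
exact: fine_cdf_nondecreasing.
Qed.

End IntegratedCdf.

(** * Integrating subgradients up to the boundary of the domain *)

Section ConvexIntegral.
Context {R : realType}.
Implicit Types (K : R -> \bar R) (q : R -> R) (a b u v w z : R).

Local Notation mu := (@lebesgue_measure R).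

(** Moves along the segment from [w] to [z], starting at the midpoint. The denominator [n.+2] keeps
    the weight of [w] strictly between 0 and 1, as [convex_ereal] requires. *)
Definition shrink z w (n : nat) : R := (z + (w - z) / n.+2%:R)%R.

Lemma shrink_cvg z w : shrink z w n @[n --> \oo] --> z.
Proof.
rewrite -[X in _ --> X](addr0 z); apply: cvgD; first exact: cvg_cst.
rewrite -[X in _ --> X](mulr0 (w - z)%R); apply: cvgMr.
by have := @cvg_harmonic R; rewrite -cvg_shiftS.
Qed.

Arguments shrink_cvg : clear implicits.

Lemma shrink_lt z w n : (z < w)%R -> (z < shrink z w n < w)%R.
Proof.
move=> zw; rewrite ltrDl divr_gt0 ?subr_gt0//=.
rewrite -ltrBrDl ltr_pdivrMr// ltr_pMr ?subr_gt0//.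
by rewrite (ltr_nat _ 1).
Qed.

Lemma shrink_gt z w n : (w < z)%R -> (w < shrink z w n < z)%R.
Proof.
have -> : shrink z w n = (- shrink (- z) (- w) n)%R.
  by rewrite /shrink opprD opprK -mulNr; congr (_ + _ / _)%R; ring.
by move=> wz; rewrite ltrNr ltrNl andbC; apply: shrink_lt; rewrite ltrN2.
Qed.

(* Lower semicontinuity bounds the limit from below, convexity along the
   segment from z to w bounds it from above. *)
Lemma convex_lower_semicontinuous_cvg K z w :
  convex_ereal K -> lower_semicontinuous K -> (forall u, 0 <= K u) ->
  K w \is a fin_num -> K (shrink z w n) @[n --> \oo] --> K z.
Proof.
move=> Kconv Klsc K0 Kw.
have Kgt r : r%:E < K z -> \forall n \near \oo, r%:E < K (shrink z w n).
  move=> /Klsc[V Vz VK]; near=> n; apply: VK.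
  by near: n; exact: (shrink_cvg z w _ Vz).
(* If [K z] is infinite, it is [+oo] by nonnegativity, and the lower bound alone gives the
   convergence. *)
have [Kz|] := boolP (K z \is a fin_num); last first.
  rewrite ge0_fin_numE// -leNgt leye_eq => /eqP Kz.
  rewrite Kz; apply/cvgeyPgt => r; apply: Kgt.
  by rewrite Kz ltry.
have Kle n : K (shrink z w n) <=
    (fine (K z) + (fine (K w) - fine (K z)) / n.+2%:R)%:E.
  have t01 : (0 < (n.+2%:R^-1 : R) < 1)%R.
    by rewrite invr_gt0 ltr0n/= invf_lt1// (ltr_nat _ 1).
  have := Kconv w z _ t01.
  rewrite -(fineK Kz) -(fineK Kw) -!EFinM -EFinD !fineK//.
  rewrite (_ : _ + _ = shrink z w n)%R; last by rewrite /shrink; ring.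
  move=> /le_trans; apply; rewrite lee_fin le_eqVlt; apply/orP; left.
  by apply/eqP; ring.
have Kfin n : K (shrink z w n) \is a fin_num.
  by rewrite ge0_fin_numE// (le_lt_trans (Kle n)) ?ltry.
rewrite -(fineK Kz); apply/fine_cvgP; split; first exact: nearW.
apply/cvgrPdist_lt => e e0.
near=> n; rewrite ltr_distlC; apply/andP; split.
  rewrite -lte_fin fineK//; near: n; apply: Kgt.
  by rewrite -[ltRHS]fineK// lte_fin ltrBlDr ltrDl.
apply: le_lt_trans (_ : shrink (fine (K z)) (fine (K w)) n < _)%R.
  by rewrite -lee_fin fineK.
near: n; have /cvgr_lt := shrink_cvg (fine (K z)) (fine (K w)); apply.
by rewrite ltrDl.
Unshelve. all: by end_near. Qed.

Lemma bigcup_shrink a b w : (a < w < b)%R ->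
  \bigcup_n `]shrink a w n, shrink b w n[%classic = `]a, b[%classic.
Proof.
move=> /andP[aw wb]; apply/seteqP; split => [x [n _]|x].
  rewrite /= !in_itv/= => /andP[ax xb].
  have /andP[an _] := shrink_lt n aw; have /andP[_ bn] := shrink_gt n wb.
  by rewrite (lt_trans an ax) (lt_trans xb bn).
rewrite /= in_itv/= => /andP[ax xb].
have [n _ hn] : \forall n \near \oo, (shrink a w n < x < shrink b w n)%R.
  near=> n; apply/andP; split; near: n.
    by have /cvgr_lt := shrink_cvg a w; exact.
  by have /cvgr_gt := shrink_cvg b w; exact.
by exists n => //; rewrite /= in_itv/= hn//=.
Unshelve. all: by end_near. Qed.

Lemma shrink_itv_nondecreasing a b w : (a < w < b)%R ->
  nondecreasing_seq (fun n => `]shrink a w n, shrink b w n[%classic : set R).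
Proof.
move=> /andP[aw wb] m n mn; rewrite subsetEset.
apply: subset_itv; rewrite bnd_simp.
  by rewrite lerD2l ler_pM2l ?subr_gt0// lef_pV2 ?posrE// ler_nat !ltnS.
by rewrite lerD2l ler_nM2l ?subr_lt0// lef_pV2 ?posrE// ler_nat !ltnS.
Qed.

(** On the compact intervals [[shrink a w n, shrink b w n]] the function [K] is finite and
    [integral_subgradient] applies. As they exhaust []a, b[], the constant sign of [q] gives
    monotone convergence of the integrals, even to an infinite value, and the values of [K] converge
    by the lemma on [shrink]. *)
Lemma integral_convex_subgradient K q a b : (a < b)%R ->
  convex_ereal K -> lower_semicontinuous K -> (forall u, 0 <= K u) ->
  (forall u, u \in `]a, b[ -> K u \is a fin_num) ->
  (forall u, u \in `]a, b[ -> subdifferential K u (q u)) ->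
  (forall u, u \in `]a, b[ -> 0 <= q u)%R \/
  (forall u, u \in `]a, b[ -> q u <= 0)%R ->
  (K a \is a fin_num \/ K b \is a fin_num) ->
  \int[mu]_(u in `]a, b[) (q u)%:E = K b - K a.
Proof.
move=> ab Kconv Klsc K0 Kfin Kq q_sign Kab.
have [aw wb] := midf_lt ab; set w := ((a + b) / 2)%R in aw wb.
have awb : (a < w < b)%R by rewrite aw.
have wab : w \in `]a, b[ by rewrite in_itv.
have Kw := Kfin _ wab.
have gK : {in `]a, b[ &, forall x y,
    q x * (y - x) <= fine (K y) - fine (K x)}%R.
  move=> x y xab yab; have := Kq _ xab y.
  by rewrite -(fineK (Kfin _ xab)) -(fineK (Kfin _ yab)) -EFinD lee_fin /=; lra.
pose D n := `]shrink a w n, shrink b w n[%classic : set R.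
have DE : \bigcup_n D n = `]a, b[%classic by exact: bigcup_shrink.
have mq n : measurable_fun (D n) (EFin \o q).
  have mqab : measurable_fun `]a, b[ (EFin \o q).
    apply/measurable_EFinP; apply: nondecreasing_in_measurable.
    exact: subgradient_nondecreasing gK.
  by apply: measurable_funS mqab => //; rewrite -DE; exact: bigcup_sup.
have ndD : nondecreasing_seq D by exact: shrink_itv_nondecreasing.
have int_cvg : \int[mu]_(u in D n) (q u)%:E @[n --> \oo] -->
    \int[mu]_(u in `]a, b[) (q u)%:E.
  have Dab n u : D n u -> u \in `]a, b[.
    by move=> Dnu; suff : `]a, b[%classic u by []; rewrite -DE; exists n.
  rewrite -DE; case: q_sign => q0.
    by apply: ge0_nondecreasing_set_cvg_integral => //[n|n u /Dab];
      [exact: measurable_itv|exact: q0].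
  by apply: le0_nondecreasing_set_cvg_integral => //[n|n u /Dab];
      [exact: measurable_itv|exact: q0].
(* Finiteness at one endpoint excludes the indeterminate difference of two infinities. *)
have KB_cvg : K (shrink b w n) - K (shrink a w n) @[n --> \oo] --> K b - K a.
  apply: cvgeB; try exact: convex_lower_semicontinuous_cvg.
  case: Kab => Kf; first by rewrite fin_num_adde_defl ?fin_numN.
  by rewrite fin_num_adde_defr.
apply: (cvg_unique _ int_cvg); first by [].
apply: cvg_trans KB_cvg; apply: near_eq_cvg; apply: nearW => n /=.
have /andP[an anw] := shrink_lt n aw; have /andP[bnw bn] := shrink_gt n wb.
have sub : {subset `[shrink a w n, shrink b w n] <= `]a, b[}.
  move=> x; rewrite !in_itv/= => /andP[ax xb].
  by rewrite (lt_le_trans an ax) (le_lt_trans xb bn).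
have anbn : (shrink a w n <= shrink b w n)%R by exact/ltW/(lt_trans anw).
rewrite (@integral_subgradient _ q (fine \o K))//; last first.
  by move=> x y /sub xab /sub; exact: gK.
by rewrite EFinB /comp !fineK//; apply/Kfin/sub; rewrite in_itv/= lexx anbn.
Qed.

End ConvexIntegral.

(** * The integrated quantile function and its subdifferential *)

Section Quantile.
Context d (T : measurableType d) (R : realType) (P : probability T R).
Context (X : {RV P >-> R}).
Implicit Types (x y u v p : R).

Local Notation F := (fine \o cdf X).
Local Notation j := (fine \o integrated_cdf X).
Local Notation K := (integrated_quantile X).

(** Galois connection between [F] and the lower quantile; right continuity makes the infimum belong
    to the set. *)
Lemma le_quantileL u x : (0 < u < 1)%R -> (quantileL X u <= x)%R = (u <= F x)%R.
Proof.
move=> /andP[u0 u1].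
have [a Fa] := cdf_lt_ex X u0; have [b Fb] := cdf_gt_ex X u1.
have SE : [set x | u%:E <= cdf X x] = [set x | (u <= F x)%R].
  by apply/seteqP; split => z /=; rewrite -lee_fin fineK// fin_num_measure.
have Slb : has_lbound [set x | (u <= F x)%R].
  exists a => z /= uz; rewrite leNgt; apply/negP => /ltW za.
  have := le_lt_trans (fine_cdf_nondecreasing X za) Fa.
  by rewrite ltNge uz.
have S0 : [set x | (u <= F x)%R] !=set0 by exists b; exact: ltW.
rewrite /quantileL SE; apply/idP/idP => [Sx|ux]; last exact: ge_inf.
apply: le_cdf_right => y xy.
have [z /= uz zy] := inf_lt S0 (le_lt_trans Sx xy).
by apply: le_trans uz _; apply: fine_cdf_nondecreasing; exact: ltW.
Qed.

(** Dual characterisation, whose right-hand side is F(x-0) <= u. Together with [le_quantileL] it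
    identifies the points between the two quantiles as those where [u] is a subgradient of [j]. *)
Lemma ge_quantileR u x : (0 < u < 1)%R ->
  (x <= quantileR X u)%R <-> (forall t, t < x -> F t <= u)%R.
Proof.
move=> /andP[u0 u1].
have [a Fa] := cdf_lt_ex X u0; have [b Fb] := cdf_gt_ex X u1.
have SE : [set x | u%:E < cdf X x] = [set x | (u < F x)%R].
  by apply/seteqP; split => z /=; rewrite -lte_fin fineK// fin_num_measure.
have Slb : has_lbound [set x | (u < F x)%R].
  exists a => z /= uz; rewrite leNgt; apply/negP => /ltW za.
  have := le_lt_trans (fine_cdf_nondecreasing X za) Fa.
  by rewrite ltNge (ltW uz).
have S0 : [set x | (u < F x)%R] !=set0 by exists b.
rewrite /quantileR SE; split => [xS t tx|Fx].
  rewrite leNgt; apply/negP => ut.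
  have : (inf [set x | (u < F x)%R] <= t)%R by exact: ge_inf.
  by rewrite leNgt (lt_le_trans tx xS).
apply: lb_le_inf => // z /= uz; rewrite leNgt; apply/negP => /Fx.
by rewrite leNgt uz.
Qed.

Lemma quantileL_le_quantileR u : (0 < u < 1)%R ->
  (quantileL X u <= quantileR X u)%R.
Proof.
move=> u01; apply/ge_quantileR => // t; rewrite ltNge le_quantileL// -ltNge.
exact: ltW.
Qed.

Lemma integrated_quantileE : K = fenchel (EFin \o j).
Proof. by rewrite /integrated_quantile -integrated_cdfE. Qed.

Lemma integrated_quantile_eqP x u : K u = (x * u - j x)%:E <->
  (forall t, t < x -> F t <= u)%R /\ (u <= F x)%R.
Proof.
by rewrite integrated_quantileE -integrated_cdf_subgradientP; exact: fenchel_eqP.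
Qed.

(** The point 0 contributes the value 0 to the supremum. *)
Lemma integrated_quantile_ge0 u : 0 <= K u.
Proof.
have := fenchel_ge j 0%R u.
by rewrite -integrated_quantileE integrated_cdf0 mul0r subr0.
Qed.

(** The supremum is attained at [quantileL X u], where [u] is a subgradient of [j]. *)
Lemma integrated_quantile_fin_num u : (0 < u < 1)%R -> K u \is a fin_num.
Proof.
move=> u01; suff /integrated_quantile_eqP -> : 
  (forall t, t < quantileL X u -> F t <= u)%R /\ (u <= F (quantileL X u))%R by [].
split; last by rewrite -le_quantileL.
by apply/ge_quantileR => //; exact: quantileL_le_quantileR.
Qed.

Lemma integrated_quantile_out u : ~~ (0 <= u <= 1)%R -> K u = +oo.
Proof.
move=> u01; apply: eq_infty => r; rewrite integrated_quantileE.
(* The subgradient inequality at [x], tested at 0. *)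
have jle x : (j x <= F x * x)%R.
  by have := integrated_cdf_subgradient X x 0; rewrite integrated_cdf0 sub0r; lra.
have /= F0 := fine_cdf_ge0 X; have /= F1 := fine_cdf_le1 X.
have r_le := ler_norm r; have r0 := normr_ge0 r.
move: u01; rewrite negb_and -!ltNge => /orP[u0|u1].
(* Here x = |r| / u is at most 0, so j(x) <= 0 and x u - j(x) is at least |r|. *)
- apply: le_trans (fenchel_ge j (`|r| / u)%R u); rewrite lee_fin.
  rewrite divfK ?lt_eqF//; apply: (le_trans r_le); rewrite lerBrDr gerDl.
  apply: le_trans (jle _) _; apply: mulr_ge0_le0; first exact: F0.
  by apply: mulr_ge0_le0 => //; rewrite invr_le0 ltW.
(* Here x is at least 0, so j(x) <= x and x u - j(x) is at least x (u - 1) = |r|. *)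
- apply: le_trans (fenchel_ge j (`|r| / (u - 1))%R u); rewrite lee_fin.
  have u10 : (0 < u - 1)%R by rewrite subr_gt0.
  set x := (`|r| / (u - 1))%R; have x0 : (0 <= x)%R by rewrite divr_ge0// ltW.
  have xE : (x * u = `|r| + x)%R.
    by rewrite -(divfK (lt0r_neq0 u10) `|r|)%R -/x; ring.
  have jx : (j x <= 1 * x)%R.
    by apply: le_trans (jle x) _; rewrite ler_wpM2r//; exact: F1.
  by rewrite xE; move: jx r_le; rewrite /=; lra.
Qed.

Lemma subdifferential_integrated_quantile u : (0 < u < 1)%R ->
  subdifferential K u = `[quantileL X u, quantileR X u]%classic.
Proof.
move=> u01; rewrite integrated_quantileE subdifferential_fenchel.
- apply/seteqP; split => x /=; rewrite integrated_cdf_subgradientP in_itv/=.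
    by move=> [/(ge_quantileR _ u01) -> ux]; rewrite le_quantileL// ux.
  by rewrite le_quantileL// => /andP[ux /(ge_quantileR _ u01)].
- by move=> x; exists (F x) => y; exact: integrated_cdf_subgradient.
- by rewrite -integrated_quantileE integrated_quantile_fin_num.
Qed.

Lemma is_quantile_subdifferential q u : (0 < u < 1)%R -> is_quantile X q ->
  subdifferential K u (q u).
Proof.
move=> u01 /(_ u u01)[/cdf_left_leP ql qr].
rewrite subdifferential_integrated_quantile//= in_itv/=.
rewrite le_quantileL// -lee_fin fineK ?fin_num_measure// qr/=.
exact/ge_quantileR.
Qed.

End Quantile.

(** * One-sided derivatives of the integrated quantile function *)

Section QuantileDerivative.
Context d (T : measurableType d) (R : realType) (P : probability T R).
Context (X : {RV P >-> R}).
Implicit Types (x y u v p h : R).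

Local Notation F := (fine \o cdf X).
Local Notation K := (integrated_quantile X).
Local Notation k := (fine \o integrated_quantile X).

Let in_subdifferential u v w : (0 < u < 1)%R -> (0 < w < 1)%R ->
  (quantileL X u <= v <= quantileR X u)%R -> (v * (w - u) <= k w - k u)%R.
Proof.
move=> u01 w01 vu; have : subdifferential K u v.
  by rewrite subdifferential_integrated_quantile//= in_itv.
move=> /(_ w); rewrite -(fineK (integrated_quantile_fin_num X u01)).
by rewrite -(fineK (integrated_quantile_fin_num X w01)) -EFinD lee_fin /=; lra.
Qed.

(** Reduces the extended-real quotient to a real one, [K] being finite near [u]; the filter is
    arbitrary so as to serve both sides. *)
Let difference_quotient_cvg (G : set_system R) (FG : ProperFilter G) u l :
  (0 < u < 1)%R -> (\forall h \near G, 0 < u + h < 1)%R ->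
  (forall e, 0 < e ->
    \forall h \near G, `|l - (k (u + h) - k u) / h| <= e)%R ->
  (K (u + h)%R - K u) * (h^-1)%:E @[h --> G] --> l%:E.
Proof.
move=> u01 uh01 lk.
apply: (@cvg_trans _ (((k (u + h) - k u) / h)%:E @[h --> G])).
  apply: near_eq_cvg; near=> h.
  rewrite EFinM EFinB /comp !fineK//; apply: integrated_quantile_fin_num => //.
  by near: h.
apply: cvg_EFin; first exact: nearW.
exact/cvgrPdist_le.
Unshelve. all: by end_near. Qed.

Let qLR := @quantileL_le_quantileR _ _ _ _ X.

(** For small h > 0 the quotient lies between q^R(u) and q^L(u + h), by the subgradient inequalities
    at u and at u + h, and q^L(u + h) <= q^R(u) + e. *)
Lemma right_derivative_integrated_quantile u : (0 < u < 1)%R ->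
  is_right_derivative K u (quantileR X u).
Proof.
move=> u01; have /andP[u0 u1] := u01.
have uh01 : (\forall h \near 0^'+, 0 < u + h < 1)%R.
  near=> h; apply/andP; split.
    by rewrite addr_gt0//; near: h; exact: nbhs_right_gt.
  by rewrite -ltrBrDl; near: h; apply: nbhs_right_lt; rewrite subr_gt0.
apply: difference_quotient_cvg => // e e0.
(* A strict inequality, so it leaves room for [u + h] below [F (quantileR X u + e)] when [h] is
   small. *)
have uFe : (u < F (quantileR X u + e))%R.
  rewrite ltNge; apply/negP => Fu.
  suff : (quantileR X u + e <= quantileR X u)%R by rewrite gerDl leNgt e0.
  apply/ge_quantileR => // t te; apply: le_trans Fu.
  by apply: fine_cdf_nondecreasing; exact: ltW.
near=> h.
have h0 : (0 < h)%R by near: h; exact: nbhs_right_gt.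
have uh : (0 < u + h < 1)%R by near: h.
have qe : (quantileL X (u + h) <= quantileR X u + e)%R.
  rewrite le_quantileL// -lerBrDl; near: h.
  by apply: nbhs_right_le; rewrite subr_gt0.
have k1 : (quantileR X u * h <= k (u + h) - k u)%R.
  have := in_subdifferential u01 uh (_ : _ <= quantileR X u <= _)%R.
  by rewrite lexx qLR// => /(_ isT); lra.
have k2 : (k (u + h) - k u <= quantileL X (u + h) * h)%R.
  have := in_subdifferential uh u01 (_ : _ <= quantileL X (u + h) <= _)%R.
  by rewrite lexx qLR// => /(_ isT); lra.
rewrite -ler_pdivlMr// in k1; rewrite -ler_pdivrMr// in k2.
by rewrite ler_norml; apply/andP; split; lra.
Unshelve. all: by end_near. Qed.

(** Same sandwich with h < 0, where division by h reverses the inequalities: q^L(u) - e <= q^L(u +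
    h) <= quotient <= q^L(u). *)
Lemma left_derivative_integrated_quantile u : (0 < u < 1)%R ->
  is_left_derivative K u (quantileL X u).
Proof.
move=> u01; have /andP[u0 u1] := u01.
have uh01 : (\forall h \near 0^'-, 0 < u + h < 1)%R.
  near=> h; apply/andP; split.
    by rewrite -ltrBlDl; near: h; apply: nbhs_left_gt; rewrite sub0r oppr_lt0.
  by rewrite (lt_trans _ u1)// gtrDl; near: h; exact: nbhs_left_lt.
apply: difference_quotient_cvg => // e e0.
have Feu : (F (quantileL X u - e) < u)%R.
  by rewrite ltNge -le_quantileL// -ltNge gtrBl.
near=> h.
have h0 : (h < 0)%R by near: h; exact: nbhs_left_lt.
have uh : (0 < u + h < 1)%R by near: h.
have qe : (quantileL X u - e <= quantileL X (u + h))%R.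
  rewrite ltW// ltNge le_quantileL// -ltNge -ltrBlDl; near: h.
  by apply: nbhs_left_gt; rewrite subr_lt0.
have k1 : (quantileL X u * h <= k (u + h) - k u)%R.
  have := in_subdifferential u01 uh (_ : _ <= quantileL X u <= _)%R.
  by rewrite lexx qLR// => /(_ isT); lra.
have k2 : (k (u + h) - k u <= quantileL X (u + h) * h)%R.
  have := in_subdifferential uh u01 (_ : _ <= quantileL X (u + h) <= _)%R.
  by rewrite lexx qLR// => /(_ isT); lra.
rewrite -ler_ndivrMr// in k1; rewrite -ler_ndivlMr// in k2.
by rewrite ler_norml; apply/andP; split; lra.
Unshelve. all: by end_near. Qed.

End QuantileDerivative.

(** * Passing from X to -X *)

Section Reflection.
Context d (T : measurableType d) (R : realType) (P : probability T R).
Context (X : {RV P >-> R}).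
Let Y : {RV P >-> R} := (- X)%R.
Implicit Types (x y u : R).

(** With [le_ccdf_cdf] this says that 1 - F_Y(x) lies between F_X(-x-0) and F_X(-x), without
    computing P(X >= -x) as a left limit. *)
Let le_cdf_ccdf x t : (t < - x)%R -> cdf Y x <= ccdf X t.
Proof.
move=> tx; rewrite /cdf /ccdf /distribution /pushforward.
apply: le_measure; rewrite ?inE.
- exact: measurable_funPTI.
- exact: measurable_funPTI.
- by move=> z /=; rewrite !in_itv/= andbT => Xz; rewrite (lt_le_trans tx)// lerNl.
Qed.

Let le_ccdf_cdf x : ccdf X (- x) <= cdf Y x.
Proof.
rewrite /cdf /ccdf /distribution /pushforward.
apply: le_measure; rewrite ?inE.
- exact: measurable_funPTI.
- exact: measurable_funPTI.
- by move=> z /=; rewrite !in_itv/= andbT => Xz; rewrite lerNl ltW.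
Qed.

(** Both sides vanish at 0 and have F_Y as a selection of subgradients, hence they have equal
    increments. *)
Lemma integrated_cdfN x :
  fine (integrated_cdf Y x) = (x + fine (integrated_cdf X (- x)))%R.
Proof.
pose jY := fine \o integrated_cdf Y.
pose G y := (y + fine (integrated_cdf X (- y)))%R.
have ccdfE t : fine (ccdf X t) = (1 - fine (cdf X t))%R.
  by rewrite ccdf_1_cdf fineB ?fin_num_measure.
(* After the change of sign the claim is that 1 - F_Y(y) is a subgradient of J_X at -y. *)
have gG a b y z : y \in `[a, b] -> z \in `[a, b] ->
    ((fine \o cdf Y) y * (z - y) <= G z - G y)%R.
  move=> _ _; suff : (fine (integrated_cdf X (- y)) +
      (1 - fine (cdf Y y)) * (- z - - y) <= fine (integrated_cdf X (- z)))%R.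
    by rewrite /G /=; lra.
  move: (- z)%R; apply/integrated_cdf_subgradientP; split => [t ty|].
    by rewrite lerBrDl -lerBrDr -ccdfE fine_le ?fin_num_measure// le_cdf_ccdf.
  by rewrite lerBlDl -lerBlDr -ccdfE fine_le ?fin_num_measure// le_ccdf_cdf.
have jG a b : (a <= b)%R -> (jY b - jY a = G b - G a)%R.
  move=> ab; apply: EFin_inj; rewrite -integral_cdf//.
  exact: integral_subgradient (@gG a b).
have jY0 : jY 0%R = 0%R := integrated_cdf0 Y.
have G0 : G 0%R = 0%R.
  by rewrite /G oppr0 add0r; exact: (integrated_cdf0 X).
suff : jY x = G x by [].
by have [/jG|/ltW /jG] := leP 0%R x; rewrite jY0 G0; lra.
Qed.

(** Substituting -x for x matches the two suprema term by term: x u - (x + J_X(-x)) = (-x)(1 - u) -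
    J_X(-x). *)
Lemma integrated_quantileN u :
  integrated_quantile Y u = integrated_quantile X (1 - u).
Proof.
rewrite !integrated_quantileE /fenchel; congr ereal_sup.
apply/seteqP; split => _ [x _ <-]; exists (- x)%R => //=;
  rewrite integrated_cdfN ?opprK -!EFinB; congr EFin; ring.
Qed.

End Reflection.

(** * Endpoint values as expectations *)

Section Expectation.
Context d (T : measurableType d) (R : realType) (P : probability T R).
Implicit Types X : {RV P >-> R}.

Local Notation mu := (@lebesgue_measure R).

Lemma integral_ccdf X x : (0 <= x)%R ->
  \int[mu]_(t in `[0%R, x[) ccdf X t = (x - fine (integrated_cdf X x))%:E.
Proof.
move=> x0; rewrite integral_itv_bndoo; last first.
  by apply: measurable_funTS; exact: ccdf_measurable.
pose j := fine \o integrated_cdf X; pose F := fine \o cdf X.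
(* The sign change turns the nonincreasing 1 - F into F - 1, a selection of subgradients of J(y) -
   y. *)
have -> : \int[mu]_(t in `]0%R, x[) ccdf X t =
    - \int[mu]_(t in `]0%R, x[) (F t - 1)%:E.
  rewrite -[LHS]oppeK -integral_ge0N//; congr (- _); apply: eq_integral => t _.
  rewrite ccdf_1_cdf fin_num_oppeB ?fin_num_measure// EFinB /F /=.
  by rewrite fineK ?fin_num_measure// addeC.
rewrite (@integral_subgradient _ _ (fun y => j y - y)%R)//.
  by congr EFin; rewrite /j integrated_cdf0 /=; ring.
move=> y z _ _; have := integrated_cdf_subgradient X y z.
by rewrite /j /F /=; lra.
Qed.

(** The tail formula writes the expectation as the integral of P(X > t) over t >= 0, the limit of n
    - J(n). Since F <= 1, x - J(x) is nondecreasing, so this limit is its supremum K(1). *)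
Lemma integrated_quantile1 X : integrated_quantile X 1 = 'E_P[X^\+].
Proof.
rewrite (@ge0_expectation_ccdf _ _ _ P (X^\+)%R); last first.
  by move=> w; exact: funrpos_ge0.
(* For t >= 0 the events X^+ > t and X > t coincide. *)
transitivity (\int[mu]_(t in `[0%R, +oo[) ccdf X t); last first.
  apply: eq_integral => t; rewrite inE/= in_itv/= andbT => t0.
  congr (P _); apply/seteqP; split => w /=; rewrite !in_itv/= !andbT lt_max.
    by move=> ->.
  by rewrite orbC ltNge t0.
pose h x := (x - fine (integrated_cdf X x))%:E.
have -> : integrated_quantile X 1 = ereal_sup (range h).
  rewrite integrated_quantileE /fenchel; congr ereal_sup.
  by apply/seteqP; split => _ [x _ <-]; exists x => //; rewrite /h mulr1 EFinB.
have h_nd : {homo h : x y / (x <= y)%R >-> x <= y}.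
  move=> x y xy; have := integrated_cdf_subgradient X y x.
  have : (fine (cdf X y) * (y - x) <= 1 * (y - x))%R.
    by rewrite ler_wpM2r ?subr_ge0// fine_cdf_le1.
  by rewrite lee_fin /=; lra.
have : h n%:R @[n --> \oo] --> ereal_sup (range h).
  move/cvge_pinftyP : (nondecreasing_cvge h_nd); apply.
  exact: cvgr_idn.
move=> /cvg_unique; apply; first by [].
have -> : `[0%R, +oo[%classic = \bigcup_n `[0%R, n%:R[%classic :> set R.
  rewrite (itv_bndy_bigcup_BLeft_shift true 0%R 0).
  by apply: eq_bigcup => // n _; rewrite add0r addn0.
rewrite (_ : (fun n => _) =
    fun n => \int[mu]_(t in `[0%R, n%:R[) ccdf X t); last first.
  by apply/funext => n; rewrite integral_ccdf.
apply: ge0_nondecreasing_set_cvg_integral => //.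
- move=> m n mn; rewrite subsetEset; apply: subset_itvl.
  by rewrite bnd_simp ler_nat.
- by move=> n; apply: measurable_funTS; exact: ccdf_measurable.
Qed.

(** By reflection K_X(0) = K_{-X}(1), and the positive part of -X is the negative part of X. *)
Lemma integrated_quantile0 X : integrated_quantile X 0 = 'E_P[X^\-].
Proof.
rewrite -[X in integrated_quantile _ X](subrr 1%R) -integrated_quantileN.
by rewrite integrated_quantile1 /= funrposN.
Qed.

End Expectation.

(** * The integral representation by quantile functions *)

Section QuantileIntegral.
Context d (T : measurableType d) (R : realType) (P : probability T R).
Implicit Types (X : {RV P >-> R}) (u v : R) (q : R -> R).

Lemma integrated_quantile_itv01 X u :
  integrated_quantile X u \is a fin_num -> (0 <= u <= 1)%R.
Proof.
by move=> Ku; apply: contraT => /(integrated_quantile_out X) E; rewrite E in Ku.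
Qed.

(** One endpoint is the zero [u0], which makes [K] finite there. The subgradient inequality at [s]
    tested at [u0] gives q(s) (s - u0) >= K(s) >= 0, so [q] has constant sign on the interval. *)
Lemma integral_quantile X q a b u0 : (a < b)%R ->
  (0 <= a)%R -> (b <= 1)%R -> is_quantile X q ->
  integrated_quantile X u0 = 0 -> u0 = a \/ u0 = b ->
  \int[lebesgue_measure]_(s in `]a, b[) (q s)%:E =
  integrated_quantile X b - integrated_quantile X a.
Proof.
move=> ab a0 b1 qX Ku0 u0ab.
have in01 s : s \in `]a, b[ -> (0 < s < 1)%R.
  rewrite in_itv/= => /andP[sa sb].
  by rewrite (le_lt_trans a0 sa) (lt_le_trans sb b1).
have qK s : s \in `]a, b[ -> subdifferential (integrated_quantile X) s (q s).
  by move=> /in01 s01; exact: is_quantile_subdifferential.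
have q_sign s : s \in `]a, b[ -> (0 <= q s * (s - u0))%R.
  move=> sab; have := qK s sab u0; have := integrated_quantile_ge0 X s.
  rewrite Ku0 -(fineK (integrated_quantile_fin_num X (in01 s sab))) -EFinD !lee_fin.
  lra.
apply: integral_convex_subgradient => //.
- by rewrite integrated_quantileE; exact: fenchel_convex.
- by rewrite integrated_quantileE; exact: fenchel_lower_semicontinuous.
- exact: integrated_quantile_ge0.
- by move=> s /in01; exact: integrated_quantile_fin_num.
- case: u0ab => u0E; [left|right] => s sab; have := q_sign s sab;
    move: sab; rewrite u0E in_itv/= => /andP[sa sb].
    by rewrite pmulr_lge0// subr_gt0.
  by rewrite nmulr_lge0// subr_lt0.
- by case: u0ab => <-; [left|right]; rewrite Ku0.
Qed.

Lemma oriented_integral_quantile X q u u0 : (0 <= u <= 1)%R ->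
  integrated_quantile X u0 = 0 -> is_quantile X q ->
  integrated_quantile X u = oriented_integral (fun s => (q s)%:E) u0 u.
Proof.
move=> /andP[u0' u1] Ku0 qX.
have /andP[u00 u01] : (0 <= u0 <= 1)%R.
  by apply: (@integrated_quantile_itv01 X); rewrite Ku0.
rewrite /oriented_integral; have [u0u|uu0] := leP u0 u; last first.
  by rewrite (@integral_quantile X q u u0 u0)//; [rewrite Ku0 sub0e oppeK|right].
move: u0u; rewrite le_eqVlt => /predU1P[<-|u0u].
  by rewrite set_itv_ge ?integral_set0// bnd_simp ltxx.
by rewrite (@integral_quantile X q u0 u u0)//; [rewrite Ku0 sube0|left].
Qed.

End QuantileIntegral.

Unset Implicit Arguments.

Theorem theorem3 (d : measure_display) (T : measurableType d) (R : realType)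
    (P : probability T R) (X : {RV P >-> R}) :
  (* (i) *)
  [/\ convex_ereal (integrated_quantile X),
      lower_semicontinuous (integrated_quantile X),
      (forall u : R, (0 < u < 1)%R -> integrated_quantile X u \is a fin_num) &
      (forall u : R, ~~ (0 <= u <= 1)%R -> integrated_quantile X u = +oo)] /\
  (* (ii) *)
  (forall x : R, integrated_cdf X x = fenchel (integrated_quantile X) x) /\
  (* (iii) *)
  [/\ (forall u : R, 0 <= integrated_quantile X u),
      (exists u : R, integrated_quantile X u = 0) &
      [set u : R | integrated_quantile X u = 0] =
      [set u : R | cdf_left X 0 <= u%:E <= cdf X 0]] /\
  (* (iv) *)
  (forall (u u0 : R) (q : R -> R), (0 <= u <= 1)%R ->
     integrated_quantile X u0 = 0 -> is_quantile X q ->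
     integrated_quantile X u = oriented_integral (fun s => (q s)%:E) u0 u) /\
  (* (v) *)
  (integrated_quantile X 0 = 'E_P[X^\-] /\
   integrated_quantile X 1 = 'E_P[X^\+]) /\
  (* (vi) *)
  (forall u : R, (0 < u < 1)%R ->
     [/\ subdifferential (integrated_quantile X) u =
           `[quantileL X u, quantileR X u]%classic,
         is_left_derivative (integrated_quantile X) u (quantileL X u) &
         is_right_derivative (integrated_quantile X) u (quantileR X u)]) /\
  (* (vii) *)
  (forall u : R, (0 <= u <= 1)%R ->
     integrated_quantile ((- X)%R : {RV P >-> R}) u =
     integrated_quantile X (1 - u)).
Proof.
(* As J(0) = 0, a zero of K is a point whose supremum is attained at x = 0; the condition is F(0-0)
   <= u <= F(0). *)
have zeroP u : integrated_quantile X u = 0 <->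
    (forall t, t < 0 -> fine (cdf X t) <= u)%R /\ (u <= fine (cdf X 0))%R.
  by rewrite -integrated_quantile_eqP integrated_cdf0 mul0r subr0.
split; first split.
- by rewrite integrated_quantileE; exact: fenchel_convex.
- by rewrite integrated_quantileE; exact: fenchel_lower_semicontinuous.
- exact: integrated_quantile_fin_num.
- exact: integrated_quantile_out.
split.
  move=> x; rewrite integrated_cdfE integrated_quantileE.
  exact: fenchel_biconjugate (integrated_cdf_subgradient X x).
split; first split.
- exact: integrated_quantile_ge0.
- exists (fine (cdf X 0)); apply/zeroP; split=> // t /ltW.
  exact: fine_cdf_nondecreasing.
- apply/seteqP; split => u /=; rewrite zeroP -lee_fin fineK ?fin_num_measure//.
    by move=> [/cdf_left_leP -> ->].
  by move=> /andP[/cdf_left_leP].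
split; first by move=> u u0 q; exact: oriented_integral_quantile.
split; first by split; [exact: integrated_quantile0|exact: integrated_quantile1].
split; last by move=> u _; exact: integrated_quantileN.
move=> u u01; split.
- exact: subdifferential_integrated_quantile.
- exact: left_derivative_integrated_quantile.
- exact: right_derivative_integrated_quantile.
Qed.
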